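(* Let $T=-T_{\mathfrak p}Q|_{\mathfrak p}+T_1Q|_{\mathfrak k_1}+\cdots+T_{r+s}Q|_{\mathfrak k_{r+s}}$ be a left-invariant $(0,2)$-tensor field on $G$ with $T_{\mathfrak p},T_1,\dots,T_{r+s}>0$. Choose an index $m\in\{1,\dots,r\}$ with $\frac{\kappa_m}{T_m}=\max_{i=1,\dots,r}\frac{\kappa_i}{T_i}$. If $$\frac{\kappa_m\,\mathrm{tr}_QT}{T_m}<\dim\mathfrak k+d_m(1-\kappa_m)-3n$$ and $$\sum_{i=1}^{r+s}\frac{n^2\kappa_iT_{\mathfrak p}^2-d_i^2(1-\kappa_i)T_i^2}{nT_{\mathfrak p}T_i}-2n<0,$$ then the functional $S|_{\mathcal M_T^+}$ attains its global maximum.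
   Context: Let $G$ be a connected non-compact simple Lie group with Lie algebra $\mathfrak g$, $K$ a maximal compact subgroup with Lie algebra $\mathfrak k$, $B$ the Killing form of $\mathfrak g$, and $\mathfrak p$ the $B$-orthogonal complement of $\mathfrak k$ in $\mathfrak g$. Let $Q=B|_{\mathfrak p}-B|_{\mathfrak k}$ (an inner product on $\mathfrak g$; $\mathrm{tr}_QT$ is the trace of $T$ with respect to $Q$, i.e. $-nT_{\mathfrak p}+\sum_id_iT_i$). Write $\mathfrak k=\mathfrak k_1\oplus\cdots\oplus\mathfrak k_{r+s}$, where $\mathfrak k_1,\dots,\mathfrak k_r$ are the simple ideals of $[\mathfrak k,\mathfrak k]$, $\mathfrak k_{r+1}$ is the centre of $\mathfrak k$, and $s=1$ if the centre is nontrivial, $s=0$ otherwise. Let $n=\dim\mathfrak p$, $d_i=\dim\mathfrak k_i$, and define $\kappa_i$ by $B_i=\kappa_iB|_{\mathfrak k_i}$, $B_i$ the Killing form of $\mathfrak k_i$. Left-invariant tensor fields on $G$ are identified with bilinear forms on $\mathfrak g$; $Q|_{\mathfrak u}$ denotes $Q$ restricted to $\mathfrak u$ and extended by zero on its $Q$-orthogonal complement. $\mathcal M_K$ is the set of left-invariant metrics on $G$ naturally reductive with respect to $G\times K$ (acting by $(x,k)y=xyk^{-1}$), which by a theorem of Gordon are exactly the metrics $\beta Q|_{\mathfrak p}+\sum_i\alpha_iQ|_{\mathfrak k_i}$ with $\beta,\alpha_i>0$. $S$ is the scalar curvature functional on $\mathcal M_K$, and $\mathcal M_T^+=\{g\in\mathcal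 M_K:\mathrm{tr}_gT=1\}$. *)

(* Defs.v *)
From HB Require Import structures.
From mathcomp Require Import all_boot all_order all_algebra.
From mathcomp Require Import reals.
Set Implicit Arguments. Unset Strict Implicit. Unset Printing Implicit Defensive.
Import Order.TTheory GRing.Theory Num.Theory.
Local Open Scope ring_scope.

(* The Lie algebra g is R^N (row vectors) with a basis e_0..e_(N-1) and a
   bracket given by structure constants  c a b = [e_a, e_b]. *)
Section LieDefs.
Variables (R : realType) (N : nat).
Implicit Types (c : 'I_N -> 'I_N -> 'rV[R]_N) (x y z : 'rV[R]_N).

Definition bvec (a : 'I_N) : 'rV[R]_N := delta_mx 0 a.

Definition lbr c x y : 'rV[R]_N :=
  \sum_(a < N) \sum_(b < N) (x 0 a * y 0 b) *: c a b.

Definition is_lie_algebra c : Prop :=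
  (forall a b, c a b = - c b a) /\
  (forall a b d, lbr c (bvec a) (lbr c (bvec b) (bvec d))
               + lbr c (bvec b) (lbr c (bvec d) (bvec a))
               + lbr c (bvec d) (lbr c (bvec a) (bvec b)) = 0).

(* ad x : the matrix whose b-th row is [x, e_b], so that  y *m adm x = [x,y] *)
Definition adm c x : 'M[R]_N := \matrix_(b < N, d < N) lbr c x (bvec b) 0 d.

Definition killing c x y : R := \tr (adm c x *m adm c y).

Definition subspace (P : 'rV[R]_N -> Prop) : Prop :=
  P 0 /\ (forall x y, P x -> P y -> P (x + y)) /\
  (forall (k : R) x, P x -> P (k *: x)).

Definition simple_lie c : Prop :=
  (exists x y, lbr c x y <> 0) /\
  forall P, subspace P -> (forall x y, P x -> P (lbr c x y)) ->
    (forall x, P x -> x = 0) \/ (forall x, P x).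

Definition in_span (q : pred 'I_N) x : Prop := forall a, ~~ q a -> x 0 a = 0.

Definition simple_sub c (q : pred 'I_N) : Prop :=
  (exists x y, in_span q x /\ in_span q y /\ lbr c x y <> 0) /\
  forall P, subspace P -> (forall x, P x -> in_span q x) ->
    (forall x y, P x -> in_span q y -> P (lbr c x y)) ->
    (forall x, P x -> x = 0) \/ (forall x, in_span q x -> P x).

(* Killing form of the subalgebra spanned by {e_a : q a} (assumed to be a
   subalgebra): trace over that subspace of ad x o ad y *)
Definition killing_sub c (q : pred 'I_N) x y : R :=
  \sum_(a < N | q a) lbr c x (lbr c y (bvec a)) 0 a.

(* ---- Riemannian geometry of a left-invariant metric, in terms of the
   Lie algebra.  Gm is the Gram matrix of the inner product in the basis e. *)
Definition ip (Gm : 'M[R]_N) x y : R := (x *m Gm *m y^T) 0 0.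

(* Levi-Civita connection on left-invariant fields (Koszul formula):
   2 <nabla_X Y, Z> = <[X,Y],Z> - <[Y,Z],X> + <[Z,X],Y> *)
Definition lc_nabla c Gm x y : 'rV[R]_N :=
  (\row_(b < N) (2^-1 * (ip Gm (lbr c x y) (bvec b)
                         - ip Gm (lbr c y (bvec b)) x
                         + ip Gm (lbr c (bvec b) x) y))) *m invmx Gm.

Definition curv c Gm x y z : 'rV[R]_N :=
  lc_nabla c Gm x (lc_nabla c Gm y z) - lc_nabla c Gm y (lc_nabla c Gm x z)
  - lc_nabla c Gm (lbr c x y) z.

Definition ricci c Gm y z : R := \sum_(a < N) curv c Gm (bvec a) y z 0 a.

Definition scal c Gm : R :=
  \sum_(a < N) \sum_(b < N) invmx Gm a b * ricci c Gm (bvec a) (bvec b).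

Definition trace_wrt (Gm Tm : 'M[R]_N) : R := \tr (invmx Gm *m Tm).
End LieDefs.
Arguments bvec {R N} a.

(* ---- The setup of the paper.  blk a = None  means e_a lies in p,
   blk a = Some i  means e_a lies in k_i (i : 'I_(r+s)); indices i < r are the
   simple ideals of [k,k], and (if s = 1) the index r is the centre of k.
   The basis e is Q-orthonormal, Q = B|p - B|k. *)
Section Setup.
Variables (R : realType) (N r s : nat).
Variables (c : 'I_N -> 'I_N -> 'rV[R]_N) (blk : 'I_N -> option 'I_(r + s)).

Definition in_p (a : 'I_N) : bool := blk a == None.
Definition in_k (a : 'I_N) : bool := blk a != None.
Definition in_ki (i : 'I_(r + s)) (a : 'I_N) : bool := blk a == Some i.

Definition dim_p : nat := #|[pred a | in_p a]|.
Definition dim_ki (i : 'I_(r + s)) : nat := #|[pred a | in_ki i a]|.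
Definition dim_k : nat := #|[pred a | in_k a]|.

Definition cartan_setup : Prop :=
  is_lie_algebra c /\
      simple_lie c /\
      (* non-compact: p <> 0 *)
      (exists a, in_p a) /\
      (* the basis is Q-orthonormal, so k and p are B-orthogonal,
         B < 0 on k and B > 0 on p *)
      (forall a b, killing c (bvec a) (bvec b) =
          (if a == b then (if in_p a then 1 else -1) else 0)) /\
      (forall a b, in_k a -> in_k b -> in_span in_k (c a b)) /\
      (forall a b, in_k a -> in_p b -> in_span in_p (c a b)) /\
      (forall a b, in_p a -> in_p b -> in_span in_k (c a b)) /\
      (s <= 1)%N /\
          (forall i, exists a, in_ki i a) /\
          (forall a b i j, in_ki i a -> in_ki j b ->
              if i == j then in_span (in_ki i) (c a b) else c a b = 0) /\
          (forall i : 'I_(r + s), (i < r)%N -> simple_sub c (in_ki i)) /\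
          (forall (i : 'I_(r + s)) a b, (r <= i)%N -> in_ki i a -> in_ki i b ->
              c a b = 0).

Definition kappa_spec (kappa : 'I_(r + s) -> R) : Prop :=
  forall i a b, in_ki i a -> in_ki i b ->
    killing_sub c (in_ki i) (bvec a) (bvec b) = kappa i * killing c (bvec a) (bvec b).

(* the metric  beta Q|p + sum_i alpha_i Q|k_i  (Gram matrix in the Q-orthonormal basis) *)
Definition nr_metric (beta : R) (alpha : 'I_(r + s) -> R) : 'M[R]_N :=
  diag_mx (\row_(a < N) match blk a with None => beta | Some i => alpha i end).

Definition tensorT (Tp : R) (Ti : 'I_(r + s) -> R) : 'M[R]_N :=
  diag_mx (\row_(a < N) match blk a with None => - Tp | Some i => Ti i end).

Definition in_MTplus (Tp : R) (Ti : 'I_(r + s) -> R) beta alpha : Prop :=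
  0 < beta /\ (forall i, 0 < alpha i) /\
  trace_wrt (nr_metric beta alpha) (tensorT Tp Ti) = 1.
End Setup.

(* Main.v *)
(** In the basis given, the tensor [A a b e = B([e_a, e_b], e_e)] is totally
    antisymmetric, and [B = Q|p - Q|k] makes [sum_(b, e in p) A a b e ^+ 2] equal to
    [1 - kappa i] for [a] in [k_i] and [sum_(b in p) sum_e A a b e ^+ 2] equal to [1/2]
    for [a] in [p].  With [x = 1/beta] and [y i = 1/alpha i] this gives
      [4 S = - 2 n x + sum_i d i (kappa i y i - (1 - kappa i) x^2 / y i)],
    to be maximised under [- n Tp x + sum_i d i T i y i = 1].  The second
    inequality makes [S] tend to minus infinity as [x] grows; [1 - kappa i > 0] (by
    simplicity of the Lie algebra) does the same when some [y i] tends to [0] while [x]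
    stays away from [0]; and as [x] tends to [0] the upper limit of [4 S] is at most
    [kappa m / T m], a value exceeded somewhere by the first inequality.  So a
    superlevel set is nonempty and contained in a compact set. *)

Require Import Defs.
From HB Require Import structures.
From mathcomp Require Import all_boot all_order all_algebra.
From mathcomp Require Import reals.
From mathcomp Require Import boolp classical_sets topology normedtype derive.
From mathcomp Require Import ring lra.
Set Implicit Arguments. Unset Strict Implicit. Unset Printing Implicit Defensive.
Import Order.TTheory GRing.Theory Num.Theory.
Import numFieldNormedType.Exports.
Local Open Scope ring_scope.

(** * The maximisation problem in the inverse scaling parameters *)

Section ReducedProblem.
Variables (R : realType) (q : nat) (d kappa T : 'I_q -> R) (n Tp : R).
Hypotheses (n_gt0 : 0 < n) (Tp_gt0 : 0 < Tp) (d_gt0 : forall i, 0 < d i)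
  (T_gt0 : forall i, 0 < T i) (kappa_ge0 : forall i, 0 <= kappa i)
  (kappa_lt1 : forall i, kappa i < 1).

(* Four times the scalar curvature, in the variables [x = 1 / beta] and
   [y i = 1 / alpha i]. *)
Definition scal4 (x : R) (y : 'I_q -> R) : R :=
  - 2 * n * x + \sum_i d i * (kappa i * y i - (1 - kappa i) * x ^+ 2 / y i).

Definition feasible (x : R) (y : 'I_q -> R) : Prop :=
  [/\ 0 < x, forall i, 0 < y i & - n * Tp * x + \sum_i d i * T i * y i = 1].

(** The constraint turns [\sum_i d i * T i * y i] into [1 + n * Tp * x], and all subtracted terms
    are nonnegative, so all but the [j]-th may be dropped. On a superlevel set, dropping that one as
    well bounds [x] from below, while keeping it bounds [y j] from below. *)
Lemma scal4_le_linear (v x : R) (y : 'I_q -> R) (j : 'I_q) :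
  (forall i, kappa i <= v * T i) -> feasible x y ->
  scal4 x y <= v * (1 + n * Tp * x) - d j * (1 - kappa j) * x ^+ 2 / y j.
Proof.
move=> kv [x0 y0 E].
have -> : 1 + n * Tp * x = \sum_i d i * T i * y i by rewrite -E; ring.
rewrite /scal4.
have H : \sum_i d i * (kappa i * y i - (1 - kappa i) * x ^+ 2 / y i) <=
   \sum_i (v * (d i * T i * y i) -
     (if i == j then d j * (1 - kappa j) * x ^+ 2 / y j else 0)).
  apply: ler_sum => i _; rewrite mulrBr; apply: lerB.
    have -> : v * (d i * T i * y i) = d i * (v * T i * y i) by ring.
    by rewrite ler_pM2l// ler_pM2r.
  case: eqP => [->|_]; first by rewrite !mulrA.
  by rewrite !mulr_ge0 ?invr_ge0 ?subr_ge0 ?sqr_ge0 // ltW.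
move: H; rewrite big_split /= sumrN -mulr_sumr -big_mkcond big_pred1_eq => H.
have h : 0 < n * x by rewrite mulr_gt0.
set S := (\sum_i _) in H *; have -> : - 2 * n * x = - (2 * (n * x)) by ring.
lra.
Qed.

(* The slope is the left-hand side of the second hypothesis of the theorem:
   each [d i * T i * y i] is at most [z = 1 + n Tp x], and
   [x^2 / z >= x / (n Tp) - 1 / (n Tp)^2]. *)
Lemma scal4_le_slope (x : R) (y : 'I_q -> R) : feasible x y ->
  scal4 x y <=
    \sum_i (kappa i / T i + d i ^+ 2 * (1 - kappa i) * T i / (n * Tp) ^+ 2)
    + (\sum_i (n ^+ 2 * kappa i * Tp ^+ 2 - d i ^+ 2 * (1 - kappa i) * T i ^+ 2)
         / (n * Tp * T i) - 2 * n) * x.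
Proof.
move=> [x0 y0 E].
have dTy0 i : 0 < d i * T i * y i by rewrite !mulr_gt0.
have ub i : d i * T i * y i <= 1 + n * Tp * x.
  have -> : 1 + n * Tp * x = \sum_i d i * T i * y i by rewrite -E; ring.
  rewrite (bigD1 i) //= lerDl; apply: sumr_ge0 => j _; exact/ltW.
rewrite mulrBl mulr_suml addrA -big_split /= /scal4 [leLHS]addrC.
have -> : - 2 * n * x = - (2 * n * x) by ring.
rewrite lerD2r; apply: ler_sum => i _.
have Ti := T_gt0 i; have di := d_gt0 i; have yi := y0 i.
have nTp : 0 < n * Tp by rewrite mulr_gt0.
set z := 1 + n * Tp * x in ub *.
have z0 : 0 < z by rewrite /z ltr_pwDl // mulr_ge0 // ltW.
have h1 : d i * kappa i * y i <= kappa i / T i * z.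
  have -> : d i * kappa i * y i = kappa i / T i * (d i * T i * y i).
    by field; rewrite gt_eqF.
  by rewrite ler_wpM2l // divr_ge0 // ltW.
have h2 : d i * (1 - kappa i) * x ^+ 2 / y i >=
    d i ^+ 2 * (1 - kappa i) * T i * (x / (n * Tp) - 1 / (n * Tp) ^+ 2).
  have -> : d i * (1 - kappa i) * x ^+ 2 / y i =
     d i ^+ 2 * (1 - kappa i) * T i * (x ^+ 2 / (d i * T i * y i)).
    by field; rewrite !gt_eqF.
  apply: ler_wpM2l.
    by rewrite !mulr_ge0 ?sqr_ge0 ?subr_ge0 // ltW.
  apply: (@le_trans _ _ (x ^+ 2 / z)); last first.
    by rewrite ler_wpM2l ?sqr_ge0 // lef_pV2 ?posrE // dTy0.
  rewrite -subr_ge0.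
  (* With [u = n * Tp * x] and [z = 1 + u], this is [u ^+ 2 - (u - 1) * (u + 1) = 1] divided by
     [(n * Tp) ^+ 2 * z]. *)
  have -> : x ^+ 2 / z - (x / (n * Tp) - 1 / (n * Tp) ^+ 2) = 1 / (n * Tp) ^+ 2 / z.
    by rewrite /z; field; rewrite !gt_eqF.
  by rewrite !divr_ge0 // ?sqr_ge0 // ltW.
have -> : d i * (kappa i * y i - (1 - kappa i) * x ^+ 2 / y i)
  = d i * kappa i * y i - d i * (1 - kappa i) * x ^+ 2 / y i by ring.
apply: (le_trans (lerB h1 h2)); rewrite le_eqVlt; apply/orP; left; apply/eqP.
by rewrite /z; field; rewrite !gt_eqF.
Qed.

(* The first hypothesis of the theorem says that the derivative at [t = 0] of
   [scal4] along the feasible curve [x = t], [y i = t] for [i != m] is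
   positive; the value at [t = 0] is [kappa m / T m]. *)
Lemma scal4_above_boundary (m : 'I_q) :
  \sum_i d i * (1 - kappa i) = n / 2 ->
  kappa m * (- n * Tp + \sum_i d i * T i) / T m
    < \sum_i d i + d m * (1 - kappa m) - 3 * n ->
  exists x y, feasible x y /\ kappa m / T m < scal4 x y.
Proof.
move=> Hn C1.
set S := \sum_(i | i != m) d i * T i.
set E := n * Tp - S.
have Tm := T_gt0 m; have dm := d_gt0 m; have km1 := kappa_lt1 m.
set D := \sum_i d i + d m * (1 - kappa m) - 3 * n
         - kappa m * (- n * Tp + \sum_i d i * T i) / T m.
have D0 : 0 < D by rewrite subr_gt0.
set K := 2 * d m ^+ 2 * T m * (1 - kappa m).
have K0 : 0 < K by rewrite !mulr_gt0 ?exprn_gt0 ?subr_gt0.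
(* The first bound gives [1 + t * E >= 1 / 2]; with it, the second keeps the error term
   [t * (K / 2) / (1 + t * E)] below the derivative [D]. *)
set t := Num.min (1 / (2 * (`|E| + 1))) (D / (2 * K)).
have E1 : 0 < `|E| + 1 by rewrite ltr_wpDl.
have t0 : 0 < t by rewrite lt_min !divr_gt0 // mulr_gt0.
have tE : t * (2 * (`|E| + 1)) <= 1.
  by rewrite -ler_pdivlMr ?mulr_gt0 // /t ge_min lexx.
have tK : t * (2 * K) <= D.
  by rewrite -ler_pdivlMr; [rewrite /t ge_min lexx orbT | exact: mulr_gt0].
have z2 : 1 / 2 <= 1 + t * E.
  have h := mulr_ge0 (ltW t0) (addr_ge0 (normr_ge0 E) (ler01)).
  have : t * - E <= t * `|E| by rewrite ler_wpM2l ?ler_normr ?lexx ?orbT // ltW.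
  rewrite mulrN; lra.
have z0 : 0 < 1 + t * E by apply: lt_le_trans z2; rewrite divr_gt0.
(* The value of [y m] forced by the constraint once [x] and the other [y i] equal [t]. *)
set ym := (1 + t * E) / (d m * T m).
exists t, (fun i => if i == m then ym else t); split.
  split => // [i|].
    by case: ifP => // _; rewrite divr_gt0 // mulr_gt0.
  rewrite (bigD1 m) //= eqxx.
  rewrite (eq_bigr (fun i => d i * T i * t)) => [|i /negbTE->] //.
  rewrite -mulr_suml -/S /ym /E; field; rewrite !gt_eqF //.
(* At [x = y i = t] the [i]-th summand of [scal4] is [d i * (2 * kappa i - 1) * t]; [Hn] evaluates
   the sum of these coefficients. *)
have SD : \sum_(i | i != m) d i * (2 * kappa i - 1) =
    \sum_i d i - n - d m * (2 * kappa m - 1).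
  have : \sum_i d i * (2 * kappa i - 1) = \sum_i d i - n.
    have -> : n = 2 * \sum_i d i * (1 - kappa i) by rewrite Hn; field.
    rewrite mulr_sumr -sumrB; apply: eq_bigr => i _; ring.
  by rewrite (bigD1 m) //= => <-; ring.
have ST : \sum_i d i * T i = d m * T m + S by rewrite (bigD1 m).
rewrite /scal4 (bigD1 m) //= eqxx.
rewrite (eq_bigr (fun i => d i * (2 * kappa i - 1) * t)); last first.
  by move=> i /negbTE->; field; rewrite gt_eqF.
rewrite -mulr_suml SD -subr_gt0.
have -> : - 2 * n * t + (d m * (kappa m * ym - (1 - kappa m) * t ^+ 2 / ym) +
   (\sum_i d i - n - d m * (2 * kappa m - 1)) * t) - kappa m / T m =
   t * (D - t * (K / 2) / (1 + t * E)).
  rewrite /D ST /K /ym /E; field; rewrite gt_eqF//= gt_eqF //=.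
  by rewrite gt_eqF // -/E.
rewrite mulr_gt0 // subr_gt0 ltr_pdivrMr //.
have tK0 : 0 < t * K by rewrite mulr_gt0.
have : D * (1 / 2) <= D * (1 + t * E) by rewrite ler_pM2l.
lra.
Qed.

(** The constraint solved for [x]: eliminating [x] leaves a problem on row vectors [y], where the
    extreme value theorem applies. *)
Definition constrained_x (y : 'I_q -> R) : R := (\sum_i d i * T i * y i - 1) / (n * Tp).

Lemma constrained_x_cvg (U : Type) (F : set_system U) {FF : Filter F}
    (Y : U -> 'I_q -> R) (y : 'I_q -> R) :
  (forall i, (Y u i @[u --> F] --> y i)%classic) ->
  (constrained_x (Y u) @[u --> F] --> constrained_x y)%classic.
Proof.
move=> Yy; apply: cvgM; last exact: cvg_cst.
apply: cvgB; last exact: cvg_cst.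
apply: cvg_big => [|i _]; first exact: add_continuous.
by apply: cvgM; [exact: cvg_cst | exact: Yy].
Qed.

Lemma scal4_cvg (U : Type) (F : set_system U) {FF : Filter F}
    (X : U -> R) (Y : U -> 'I_q -> R) (x : R) (y : 'I_q -> R) :
  (X @ F --> x)%classic -> (forall i, (Y u i @[u --> F] --> y i)%classic) ->
  (forall i, y i != 0) ->
  (scal4 (X u) (Y u) @[u --> F] --> scal4 x y)%classic.
Proof.
move=> Xx Yy yn0; apply: cvgD; first by apply: cvgM; [exact: cvg_cst | exact: Xx].
apply: cvg_big => [|i _]; first exact: add_continuous.
apply: cvgM; first exact: cvg_cst.
apply: cvgB; first by apply: cvgM; [exact: cvg_cst | exact: Yy].
apply: cvgM; last by apply: cvgV; [exact: yn0 | exact: Yy].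
by apply: cvgM; [exact: cvg_cst | exact: (cvgM Xx Xx)].
Qed.

Lemma max_scal4_exists (m : 'I_q) :
  (forall i, kappa i / T i <= kappa m / T m) ->
  \sum_i d i * (1 - kappa i) = n / 2 ->
  kappa m * (- n * Tp + \sum_i d i * T i) / T m
    < \sum_i d i + d m * (1 - kappa m) - 3 * n ->
  \sum_i (n ^+ 2 * kappa i * Tp ^+ 2 - d i ^+ 2 * (1 - kappa i) * T i ^+ 2)
    / (n * Tp * T i) - 2 * n < 0 ->
  exists x y, feasible x y /\ forall x' y', feasible x' y' -> scal4 x' y' <= scal4 x y.
Proof.
move=> maxm Hn C1 C2.
have [xt [yt [ft gt_v]]] := scal4_above_boundary Hn C1.
set v := kappa m / T m in maxm gt_v.
set V := scal4 xt yt in gt_v.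
have kv i : kappa i <= v * T i by rewrite -ler_pdivrMr.
have v0 : 0 <= v by rewrite divr_ge0 // ltW.
have nTp : 0 < n * Tp by rewrite mulr_gt0.
have dT0 i : 0 < d i * T i by rewrite mulr_gt0.
(* [C2] makes the slope in [scal4_le_slope] negative, so a value of at least [V] bounds [x] from
   above. *)
have [X X0 leX] : exists2 X, 0 < X & forall x y, feasible x y -> V <= scal4 x y -> x <= X.
  have [B [s [s0 hs]]] : exists B s, s < 0 /\
      forall x y, feasible x y -> scal4 x y <= B + s * x.
    by do 2!eexists; split; [exact: C2 | exact: scal4_le_slope].
  exists (`|B - V| / (- s) + 1) => [|x y fxy Vle].
    by rewrite ltr_wpDl // divr_ge0 // oppr_ge0 ltW.
  have h := le_trans Vle (hs _ _ fxy).
  apply: (@le_trans _ _ (`|B - V| / (- s))); last by rewrite lerDl.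
  rewrite ler_pdivlMr ?oppr_gt0 //; apply: le_trans (ler_norm _); lra.
(* From [V <= v * (1 + n * Tp * x)] follows [V - v <= v * (n * Tp) * x]; the added 1 keeps the
   denominator positive when [v = 0]. *)
pose x0 := (V - v) / (v * (n * Tp) + 1).
have vnTp : 0 < v * (n * Tp) + 1 by rewrite ltr_wpDl // mulr_ge0 // ltW.
have x0_gt0 : 0 < x0 by rewrite divr_gt0 // subr_gt0.
have gex0 x y : feasible x y -> V <= scal4 x y -> x0 <= x.
  move=> fxy Vle; have [xpos ypos _] := fxy.
  have h := le_trans Vle (scal4_le_linear m kv fxy).
  have h2 : 0 <= d m * (1 - kappa m) * x ^+ 2 / y m.
    by rewrite !mulr_ge0 ?invr_ge0 ?subr_ge0 ?sqr_ge0 // ltW.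
  rewrite ler_pdivrMr //; lra.
(* On the superlevel set [W] bounds each [d i * (1 - kappa i) * x ^+ 2 / y i]; since [x >= x0], this
   keeps [y i] away from 0. *)
pose W := v * (1 + n * Tp * X) - V.
have [dl dl0 ledl] : exists2 dl, 0 < dl & forall x y, feasible x y -> V <= scal4 x y ->
    forall i, dl <= y i.
  pose a i := d i * (1 - kappa i) * x0 ^+ 2.
  have a0 i : 0 < a i by apply: mulr_gt0; rewrite ?exprn_gt0 // mulr_gt0 // subr_gt0.
  have W1 : 0 < `|W| + 1 by rewrite ltr_wpDl.
  exists (\big[Num.min/1]_i (a i / (`|W| + 1))).
    by elim/big_ind: _ => // [u w u0 w0|i _]; rewrite ?lt_min ?u0 // divr_gt0.
  move=> x y fxy Vle i; have [xpos ypos _] := fxy.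
  have h := le_trans Vle (scal4_le_linear i kv fxy).
  apply: (@le_trans _ _ (a i / (`|W| + 1))); first exact: bigmin_le.
  rewrite ler_pdivrMr // mulrC -ler_pdivrMr //.
  apply: (@le_trans _ _ (d i * (1 - kappa i) * x ^+ 2 / y i)).
    rewrite ler_pM2r ?invr_gt0 // ler_pM2l ?mulr_gt0 ?subr_gt0 //.
    by rewrite ler_sqr ?nnegrE ?(ltW x0_gt0) ?(ltW xpos) // (gex0 _ _ fxy).
  have hX : v * (n * Tp * x) <= v * (n * Tp * X).
    by rewrite ler_wpM2l // ler_pM2l // (leX _ _ fxy).
  have := ler_norm W; rewrite {1}/W; lra.
pose M i := (1 + n * Tp * X) / (d i * T i).
have leM x y : feasible x y -> V <= scal4 x y -> forall i, y i <= M i.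
  move=> fxy Vle i; have [xpos ypos E] := fxy.
  rewrite ler_pdivlMr // mulrC.
  apply: (@le_trans _ _ (\sum_i d i * T i * y i)).
    by rewrite (bigD1 i) //= lerDl sumr_ge0 // => j _; rewrite ltW // mulr_gt0.
  have -> : \sum_i d i * T i * y i = 1 + n * Tp * x by rewrite -E; ring.
  by rewrite lerD2l ler_pM2l // (leX _ _ fxy).
pose xof (w : 'rV[R]_q) := constrained_x (fun i => w 0 i).
(* The closed condition [x0 <= xof w] stands in for the open condition [0 < x], so that [A] is
   closed in a compact box and still consists of feasible points. *)
pose A := [set w : 'rV[R]_q | (forall i, `[dl, M i]%classic (w 0 i)) /\ x0 <= xof w]%classic.
have xofE x y : feasible x y -> xof (\row_i y i) = x.
  move=> [_ _ E]; rewrite /xof /constrained_x -E.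
  rewrite (eq_bigr (fun i => d i * T i * y i)) => [|i _]; last by rewrite mxE.
  by field; rewrite !gt_eqF.
have rowE (y : 'I_q -> R) : (fun i => (\row_i y i : 'rV[R]_q) 0 i) = y.
  by apply/funext => i; rewrite mxE.
have inA x y : feasible x y -> V <= scal4 x y -> A (\row_i y i).
  move=> fxy Vle; split=> [i|]; last by rewrite (xofE _ _ fxy) (gex0 _ _ fxy).
  by rewrite mxE /= in_itv /= (ledl _ _ fxy) // (leM _ _ fxy).
have xof_cont : continuous xof.
  by move=> w; apply: (@constrained_x_cvg _ (nbhs w)) => i; exact: coord_continuous.
pose box := [set w : 'rV[R]_q | forall i, `[dl, M i]%classic (w 0 i)]%classic.
have box_compact : compact box.
  by apply: (@rV_compact _ _ (fun i => `[dl, M i]%classic)) => i; exact: segment_compact.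
have Acpt : compact A.
  apply: (@subclosed_compact _ _ box) => //; last by move=> w [].
  apply: (@closedI _ box (xof @^-1` [set u | x0 <= u])%classic).
    by apply: compact_closed box_compact; exact: norm_hausdorff.
  by apply: preimage_closed; [move=> w _; exact: xof_cont | exact: closed_ge].
pose f (w : 'rV[R]_q) := scal4 (xof w) (fun i => w 0 i).
have Apos w : A w -> forall i, 0 < w 0 i.
  by move=> [h _] i; have := h i; rewrite /= in_itv /= => /andP[+ _]; apply: lt_le_trans.
have fcont : {within A, continuous f}%classic.
  apply: continuous_in_subspaceT => w /set_mem Aw.
  apply: (@scal4_cvg _ (nbhs w)) => [|i|i]; [exact: xof_cont | exact: coord_continuous |].
  by rewrite gt_eqF // Apos.
have [w /set_mem Aw maxw] : exists2 c, c \in A & forall t, t \in A -> f t <= f c.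
  by apply: EVT_max_rV => //; exists (\row_i yt i); apply: inA ft _.
have [_ xw] := Aw.
exists (xof w), (fun i => w 0 i); split.
  split; [exact: lt_le_trans xw | exact: Apos|].
  by rewrite /xof /constrained_x; field; rewrite !gt_eqF.
have maxA x y : feasible x y -> V <= scal4 x y -> scal4 x y <= f w.
  move=> fxy Vle; have := maxw (\row_i y i) (mem_set (inA _ _ fxy Vle)).
  by rewrite {1}/f (xofE _ _ fxy) rowE.
(* Feasible points of value below [V] are beaten by [(xt, yt)], which lies in [A]. *)
move=> x y fxy; have [Vle|/ltW ltV] := leP V (scal4 x y); first exact: maxA.
by apply: le_trans ltV _; apply: maxA.
Qed.
End ReducedProblem.

(** * Connection and curvature of a diagonal left-invariant metric *)

Section DiagonalMetric.
Variables (R : realType) (N : nat) (c : 'I_N -> 'I_N -> 'rV[R]_N).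

Lemma lbrE x y e : lbr c x y 0 e = \sum_a \sum_b x 0 a * y 0 b * c a b 0 e.
Proof.
rewrite /lbr summxE; apply: eq_bigr => a _; rewrite summxE.
by apply: eq_bigr => b _; rewrite mxE.
Qed.

Lemma sum_bvec (F : 'I_N -> R) a : \sum_b (bvec a : 'rV[R]_N) 0 b * F b = F a.
Proof.
rewrite (bigD1 a) //= big1 => [|b ba]; rewrite !mxE ?eqxx ?(negbTE ba) /=.
  by rewrite mul1r addr0.
by rewrite mul0r.
Qed.

Lemma lbr_bvecl a y e : lbr c (bvec a) y 0 e = \sum_b y 0 b * c a b 0 e.
Proof.
rewrite lbrE -(sum_bvec (fun a => \sum_b y 0 b * c a b 0 e)).
apply: eq_bigr => i _; rewrite mulr_sumr; apply: eq_bigr => j _; ring.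
Qed.

Lemma lbr_bvecr x b e : lbr c x (bvec b) 0 e = \sum_a x 0 a * c a b 0 e.
Proof.
rewrite lbrE; apply: eq_bigr => a _.
rewrite -(sum_bvec (fun b => x 0 a * c a b 0 e)).
by apply: eq_bigr => i _; ring.
Qed.

Lemma lbr_bvec a b : lbr c (bvec a) (bvec b) = c a b.
Proof. by apply/rowP => e; rewrite lbr_bvecl sum_bvec. Qed.

Lemma adm_bvecE a b e : adm c (bvec a) b e = c a b 0 e.
Proof. by rewrite mxE lbr_bvec. Qed.

Lemma invmx_diag (g : 'rV[R]_N) : (forall a, g 0 a != 0) ->
  invmx (diag_mx g) = diag_mx (\row_a (g 0 a)^-1).
Proof.
move=> gn0; have gV : diag_mx g *m diag_mx (\row_a (g 0 a)^-1) = 1%:M.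
  apply/matrixP => a b; rewrite mul_diag_mx !mxE.
  by case: eqP => [->|_]; rewrite ?mulr1n ?mulr0n ?mulr0 // divff.
have [gu _] := mulmx1_unit gV.
by rewrite -[LHS]mulmx1 -gV mulmxA mulVmx // mul1mx.
Qed.

Lemma ip_diag (g x y : 'rV[R]_N) : ip (diag_mx g) x y = \sum_a x 0 a * g 0 a * y 0 a.
Proof.
rewrite /ip mxE; apply: eq_bigr => a _; rewrite mul_mx_diag !mxE; ring.
Qed.

(* [A] is the totally antisymmetric tensor [B([e_a, e_b], e_e)] of an
   orthonormal basis with signs [eps]; the curvature of the diagonal metric [g]
   depends on [g] and the signed weights [h = eps g] only through [A ^+ 2]. *)
Variables (eps : 'I_N -> R) (A : 'I_N -> 'I_N -> 'I_N -> R) (g : 'rV[R]_N).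
Hypotheses (cA : forall a b e, c a b 0 e = A a b e * eps e)
  (A_cyc : forall a b e, A a b e = A b e a)
  (A_anti : forall a b e, A a b e = - A b a e)
  (g_neq0 : forall a, g 0 a != 0).

Let h a := eps a * g 0 a.

(** The [e]-th coordinate of the covariant derivative of [e_b] along [e_a]: by cyclicity of [A] the
    three brackets in the Koszul formula are all multiples of [A a b e]. *)
Definition christoffel a b e : R := A a b e * (h e - h a + h b) / (2 * g 0 e).

Lemma lc_nabla_diag x y e :
  lc_nabla c (diag_mx g) x y 0 e = \sum_a \sum_b x 0 a * y 0 b * christoffel a b e.
Proof.
rewrite /lc_nabla invmx_diag // mul_mx_diag !mxE !ip_diag.
have -> : \sum_a lbr c x y 0 a * g 0 a * (bvec e : 'rV[R]_N) 0 a =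
    \sum_a \sum_b x 0 a * y 0 b * c a b 0 e * g 0 e.
  rewrite -(eq_bigr _ (fun i _ => mulr_suml _ _ _ _)) -mulr_suml -lbrE.
  by rewrite -[RHS](sum_bvec (fun e => lbr c x y 0 e * g 0 e)); apply: eq_bigr => i _; ring.
have -> : \sum_a lbr c y (bvec e) 0 a * g 0 a * x 0 a =
    \sum_a \sum_b x 0 a * y 0 b * c b e 0 a * g 0 a.
  apply: eq_bigr => a _; rewrite lbr_bvecr -mulrA mulr_suml.
  by apply: eq_bigr => b _; ring.
have -> : \sum_a lbr c (bvec e) x 0 a * g 0 a * y 0 a =
    \sum_a \sum_b x 0 a * y 0 b * c e a 0 b * g 0 b.
  rewrite exchange_big; apply: eq_bigr => a _; rewrite lbr_bvecl -mulrA mulr_suml.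
  by apply: eq_bigr => b _; ring.
rewrite -sumrB -big_split mulr_sumr mulr_suml; apply: eq_bigr => a _.
rewrite -sumrB -big_split mulr_sumr mulr_suml; apply: eq_bigr => b _ /=.
rewrite !cA -(A_cyc a b e) (A_cyc e a b) /christoffel /h; field.
exact: g_neq0.
Qed.

Lemma lc_nabla_diag_bvecl a y e :
  lc_nabla c (diag_mx g) (bvec a) y 0 e = \sum_b y 0 b * christoffel a b e.
Proof.
rewrite lc_nabla_diag -(sum_bvec (fun a => \sum_b y 0 b * christoffel a b e)).
apply: eq_bigr => i _; rewrite mulr_sumr; apply: eq_bigr => j _; ring.
Qed.

Lemma lc_nabla_diag_bvecr x b e :
  lc_nabla c (diag_mx g) x (bvec b) 0 e = \sum_a x 0 a * christoffel a b e.
Proof.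
rewrite lc_nabla_diag; apply: eq_bigr => a _.
rewrite -(sum_bvec (fun b => x 0 a * christoffel a b e)).
by apply: eq_bigr => i _; ring.
Qed.

Lemma lc_nabla_diag_bvec a b e :
  lc_nabla c (diag_mx g) (bvec a) (bvec b) 0 e = christoffel a b e.
Proof. by rewrite lc_nabla_diag_bvecl sum_bvec. Qed.

(** In the curvature applied to [e_a], [e_b], [e_b], the first term vanishes because [A b b e = 0];
    antisymmetry makes each of the other two a sum over [e] of multiples of [A a b e ^+ 2]. *)
Lemma ricci_diag b : ricci c (diag_mx g) (bvec b) (bvec b) =
  - \sum_a \sum_e A a b e ^+ 2 / (4 * g 0 a * g 0 e) *
     (3 * h e ^+ 2 - h a ^+ 2 - h b ^+ 2 + 2 * h a * h b - 2 * h e * h a - 2 * h e * h b).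
Proof.
rewrite /ricci -sumrN; apply: eq_bigr => a _.
have subE (u v w : 'rV[R]_N) : (u - v - w) 0 a = u 0 a - v 0 a - w 0 a by rewrite !mxE.
rewrite /curv subE lbr_bvec lc_nabla_diag_bvecl lc_nabla_diag_bvecl lc_nabla_diag_bvecr.
rewrite -sumrB -sumrB -sumrN; apply: eq_bigr => e _.
rewrite !lc_nabla_diag_bvec cA.
have Abb : A b b e = 0 by have := A_anti b b e; lra.
have Aeba : A e b a = - A a b e by rewrite A_anti -A_cyc A_anti opprK A_anti.
rewrite /christoffel Abb Aeba (A_cyc b e a) (A_cyc e a b).
have ge := g_neq0 e; have ga := g_neq0 a.
have -> : A a b e * eps e = A a b e * (h e / g 0 e) by rewrite /h mulfK.
by field; rewrite ga ge.
Qed.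

(** The inverse Gram matrix is diagonal, so only the diagonal Ricci entries contribute. *)
Lemma scal_diag : 4 * scal c (diag_mx g) =
  - \sum_a \sum_b \sum_e A a b e ^+ 2 / (g 0 a * g 0 b * g 0 e) *
     (3 * h e ^+ 2 - h a ^+ 2 - h b ^+ 2 + 2 * h a * h b - 2 * h e * h a - 2 * h e * h b).
Proof.
rewrite exchange_big /= /scal mulr_sumr -sumrN; apply: eq_bigr => b _.
rewrite (bigD1 b) //= big1 ?addr0 => [|a ab]; last first.
  by rewrite invmx_diag // !mxE eq_sym (negbTE ab) mulr0n mul0r.
rewrite invmx_diag // !mxE eqxx mulr1n ricci_diag !mulrN; congr (- _).
rewrite mulrA mulr_sumr; apply: eq_bigr => a _.
rewrite mulr_sumr; apply: eq_bigr => e _.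
by field; rewrite !g_neq0.
Qed.
End DiagonalMetric.

(** * Invariance of the Killing form in an orthonormal basis *)

Section KillingBasis.
Variables (R : realType) (N : nat) (c : 'I_N -> 'I_N -> 'rV[R]_N) (eps : 'I_N -> R).
Hypotheses (lie : is_lie_algebra c) (eps2 : forall a, eps a * eps a = 1)
  (killing_eps : forall a b, killing c (bvec a) (bvec b) = if a == b then eps a else 0).

(** This is [B([e_a, e_b], e_e)]: the last index of the structure constants lowered with the Killing
    form. *)
Definition killing3 a b e : R := c a b 0 e * eps e.

Lemma structure_killing3 a b e : c a b 0 e = killing3 a b e * eps e.
Proof. by rewrite /killing3 -mulrA eps2 mulr1. Qed.

Lemma structure_anti a b e : c a b 0 e = - c b a 0 e.
Proof. by have [anti _] := lie; rewrite anti mxE. Qed.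

Lemma killing3_anti a b e : killing3 a b e = - killing3 b a e.
Proof. by rewrite /killing3 structure_anti mulNr. Qed.

Lemma jacobi_structure a b d e :
  \sum_f c b d 0 f * c a f 0 e + \sum_f c d a 0 f * c b f 0 e
  + \sum_f c a b 0 f * c d f 0 e = 0.
Proof.
have [_ /(_ a b d)/rowP/(_ e)] := lie.
have addE (u v w : 'rV[R]_N) : (u + v + w) 0 e = u 0 e + v 0 e + w 0 e by rewrite !mxE.
by rewrite addE !lbr_bvec !lbr_bvecl mxE.
Qed.

(** The Jacobi identity says that [ad] is a homomorphism; the commutator appears reversed because
    [adm] acts on row vectors from the right. *)
Lemma adm_bracket a b : \sum_f c a b 0 f *: adm c (bvec f) =
  adm c (bvec b) *m adm c (bvec a) - adm c (bvec a) *m adm c (bvec b).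
Proof.
apply/matrixP => d e.
have addE (u v : 'M[R]_N) : (u - v) d e = u d e - v d e by rewrite !mxE.
have -> : (\sum_f c a b 0 f *: adm c (bvec f)) d e = - \sum_f c a b 0 f * c d f 0 e.
  rewrite summxE -sumrN; apply: eq_bigr => f _.
  by rewrite mxE adm_bvecE (structure_anti f d) mulrN.
have mulE u v : (adm c (bvec u) *m adm c (bvec v)) d e = \sum_f c u d 0 f * c v f 0 e.
  by rewrite mxE; apply: eq_bigr => f _; rewrite !adm_bvecE.
have adE : \sum_f c a d 0 f * c b f 0 e = - \sum_f c d a 0 f * c b f 0 e.
  by rewrite -sumrN; apply: eq_bigr => f _; rewrite structure_anti mulNr.
have J := jacobi_structure a b d e.
rewrite addE !mulE adE; lra.
Qed.

Lemma killing3_trace a b e : killing3 a b e =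
  \tr ((adm c (bvec b) *m adm c (bvec a) - adm c (bvec a) *m adm c (bvec b))
       *m adm c (bvec e)).
Proof.
rewrite -adm_bracket mulmx_suml raddf_sum /=.
rewrite (bigD1 e) //= big1 => [|f fe].
  by rewrite addr0 -scalemxAl mxtraceZ -/(killing c (bvec e) (bvec e)) killing_eps eqxx.
by rewrite -scalemxAl mxtraceZ -/(killing c (bvec f) (bvec e)) killing_eps (negbTE fe) mulr0.
Qed.

(** Invariance of the Killing form, from the cyclicity of the trace. *)
Lemma killing3_cyc a b e : killing3 a b e = killing3 b e a.
Proof.
rewrite !killing3_trace !mulmxBl !raddfB /=; congr (_ - _).
  by rewrite mxtrace_mulC mulmxA.
by rewrite -mulmxA mxtrace_mulC.
Qed.

Lemma killing3_swap a b e : killing3 a e b = - killing3 a b e.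
Proof. by rewrite killing3_anti (killing3_cyc e). Qed.

(** This expands [B(e_a, e_a)] as the trace of the square of [ad e_a]; exchanging the last two
    indices produces the sign. *)
Lemma sum_killing3_sqr a :
  \sum_b \sum_e killing3 a b e ^+ 2 * (eps b * eps e) = - eps a.
Proof.
have := killing_eps a a; rewrite eqxx /killing /mxtrace => <-; rewrite -sumrN.
apply: eq_bigr => b _; rewrite mxE -sumrN; apply: eq_bigr => e _.
rewrite !adm_bvecE !structure_killing3 (killing3_swap a b e); ring.
Qed.

Lemma killing_sub_killing3 (q : pred 'I_N) a : killing_sub c q (bvec a) (bvec a) =
  - \sum_(b | q b) \sum_e killing3 a b e ^+ 2 * (eps b * eps e).
Proof.
rewrite /killing_sub -sumrN; apply: eq_bigr => b _; rewrite lbr_bvec lbr_bvecl -sumrN.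
by apply: eq_bigr => e _; rewrite !structure_killing3 (killing3_swap a b e); ring.
Qed.
End KillingBasis.

(** * Sums of squares of structure constants along the Cartan decomposition *)

Section KillingSums.
Variables (R : realType) (N r s : nat).
Variables (c : 'I_N -> 'I_N -> 'rV[R]_N) (blk : 'I_N -> option 'I_(r + s)).
Variable kappa : 'I_(r + s) -> R.
Hypotheses (setup : cartan_setup c blk) (kappaE : kappa_spec c blk kappa).

Definition cartan_sign a : R := if in_p blk a then 1 else -1.
Local Notation eps := cartan_sign.
Local Notation A := (killing3 c eps).

Lemma cartan_sign2 a : eps a * eps a = 1.
Proof. by rewrite /eps; case: ifP => _; rewrite ?mulrNN mulr1. Qed.

Lemma cartan_killing a b : killing c (bvec a) (bvec b) = if a == b then eps a else 0.
Proof. by case: setup => _ [_ [_ [-> _]]]. Qed.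

Lemma in_kE a : in_k blk a = ~~ in_p blk a.
Proof. by []. Qed.

Lemma killing3_in_kp a b e : in_k blk a -> in_p blk b -> ~~ in_p blk e -> A a b e = 0.
Proof.
case: setup => _ [_ [_ [_ [_ [kp _]]]]] ak bp ep.
by rewrite /killing3 (kp a b) ?mul0r.
Qed.

Lemma killing3_in_pp a b e : in_p blk a -> in_p blk b -> in_p blk e -> A a b e = 0.
Proof.
case: setup => _ [_ [_ [_ [_ [_ [pp _]]]]]] ap bp ep.
by rewrite /killing3 (pp a b) ?mul0r // in_kE ep.
Qed.

Lemma killing3_in_ki i a b e :
  in_ki blk i a -> in_k blk b -> ~~ (in_ki blk i b && in_ki blk i e) -> A a b e = 0.
Proof.
case: setup => _ [_ [_ [_ [_ [_ [_ [_ [_ [bl _]]]]]]]]] ai bk.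
rewrite /killing3; case bE: (blk b) bk => [j|]; rewrite /in_k bE // => _.
have bj : in_ki blk j b by rewrite /in_ki bE.
have := bl a b i j ai bj; case: (i =P j) => [ij|_ ->]; last by rewrite mxE mul0r.
by rewrite -ij in bj *; rewrite bj /= => h he; rewrite h ?mul0r.
Qed.

Lemma killing3_out_k i a b : in_ki blk i a -> ~~ in_p blk b ->
  forall e, A a b e != 0 -> in_ki blk i b /\ in_ki blk i e.
Proof.
move=> ai bk e; case: (boolP (in_ki blk i b && in_ki blk i e)) => [/andP[]//|nin].
by rewrite (killing3_in_ki ai bk nin) eqxx.
Qed.

Lemma in_ki_k i a : in_ki blk i a -> in_k blk a.
Proof. by rewrite /in_ki /in_k => /eqP->. Qed.

Lemma in_ki_sign i a : in_ki blk i a -> eps a = -1.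
Proof. by rewrite /eps /in_ki /in_p => /eqP->. Qed.

Lemma killing3_cycle a b e : A a b e = A b e a.
Proof. by case: setup => lie _; exact: (killing3_cyc lie cartan_killing). Qed.

Lemma killing3_antil a b e : A a b e = - A b a e.
Proof. by case: setup => lie _; exact: killing3_anti. Qed.

Lemma sqr_killing3_swap a b e : A a b e ^+ 2 = A b a e ^+ 2.
Proof. by rewrite killing3_antil sqrrN. Qed.

Lemma sqr_killing3_swapr a b e : A a b e ^+ 2 = A a e b ^+ 2.
Proof. by rewrite killing3_cycle sqr_killing3_swap -killing3_cycle -killing3_cycle. Qed.

(** The Killing form of [k_i] at [e_a] is [- kappa i]. Nonzero terms have [b] and [e] in [k_i],
    where the two signs multiply to 1. *)
Lemma sum_killing3_ki i a : in_ki blk i a ->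
  \sum_(b | in_ki blk i b) \sum_e A a b e ^+ 2 = kappa i.
Proof.
move=> ai; case: (setup) => lie _.
have := kappaE ai ai; rewrite cartan_killing eqxx (in_ki_sign ai) mulrN1.
rewrite (killing_sub_killing3 lie cartan_sign2 cartan_killing) => /oppr_inj <-.
apply: eq_bigr => b bi; apply: eq_bigr => e _.
case: (eqVneq (A a b e) 0) => [->|nz]; first by rewrite expr0n mul0r.
have [_ ei] := killing3_out_k ai (in_ki_k bi) nz.
by rewrite (in_ki_sign bi) (in_ki_sign ei) mulrNN !mulr1.
Qed.

Lemma sum_killing3_k i a : in_ki blk i a ->
  \sum_(b | in_k blk b) \sum_e A a b e ^+ 2 = kappa i.
Proof.
move=> ai; rewrite -(sum_killing3_ki ai) (bigID (in_ki blk i)) /=.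
rewrite [X in _ + X]big1 ?addr0 => [|b /andP[bk bi]].
  by apply: eq_bigl => b; case: (boolP (in_ki blk i b)) => [/in_ki_k->|_]; rewrite ?andbF.
rewrite big1 // => e _; rewrite (killing3_in_ki ai bk) ?expr0n //.
by rewrite (negbTE bi).
Qed.

(** The signed sum over all [b] and [e] is 1, and the part with [b] in [k] is [kappa i]. For [b] in
    [p] only [e] in [p] contributes, with positive sign. *)
Lemma sum_killing3_p i a : in_ki blk i a ->
  \sum_(b | in_p blk b) \sum_e A a b e ^+ 2 = 1 - kappa i.
Proof.
move=> ai; case: (setup) => lie _.
have := sum_killing3_sqr lie cartan_sign2 cartan_killing a.
rewrite (in_ki_sign ai) opprK -(sum_killing3_k ai) (bigID (in_p blk)) /= => <-.
rewrite -addrA (_ : _ - _ = 0) ?addr0.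
  apply: eq_bigr => b bp; apply: eq_bigr => e _.
  case: (boolP (in_p blk e)) => ep; last first.
    by rewrite (killing3_in_kp (in_ki_k ai) bp ep) expr0n mul0r.
  by rewrite /eps bp ep !mulr1.
apply/eqP; rewrite subr_eq0; apply/eqP.
apply: eq_bigr => b bk; apply: eq_bigr => e _.
case: (eqVneq (A a b e) 0) => [->|nz]; first by rewrite expr0n mul0r.
have [bi ei] := killing3_out_k ai bk nz.
by rewrite (in_ki_sign bi) (in_ki_sign ei) mulrNN !mulr1.
Qed.

(** Nonzero terms have exactly one of [b], [e] in [p]. The two cases have equal sums by symmetry,
    both enter with sign -1, and the signed total is -1. *)
Lemma sum_killing3_pp a : in_p blk a ->
  \sum_(b | in_p blk b) \sum_e A a b e ^+ 2 = 2^-1.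
Proof.
move=> ap; case: (setup) => lie _.
set S := \sum_(b | _) _.
have Spk : S = \sum_(b | in_p blk b) \sum_(e | in_k blk e) A a b e ^+ 2.
  apply: eq_bigr => b bp; rewrite (bigID (in_p blk)) /= big1 ?add0r // => e ep.
  by rewrite killing3_in_pp ?expr0n.
have Skp : S = \sum_(b | in_k blk b) \sum_e A a b e ^+ 2.
  rewrite Spk exchange_big /=; apply: eq_bigr => b bk.
  rewrite [RHS](bigID (in_p blk)) /= [X in _ + X]big1 ?addr0 => [|e ep].
    by apply: eq_bigr => e ep; rewrite sqr_killing3_swapr.
  by rewrite sqr_killing3_swap killing3_in_kp ?expr0n.
have := sum_killing3_sqr lie cartan_sign2 cartan_killing a.
rewrite (bigID (in_p blk)) /= (_ : \sum_(i | in_p blk i) _ = - S); last first.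
  rewrite Spk -sumrN; apply: eq_bigr => b bp.
  rewrite (bigID (in_p blk)) /= big1 ?add0r => [|e ep]; last first.
    by rewrite killing3_in_pp ?expr0n ?mul0r.
  by rewrite -sumrN; apply: eq_bigr => e ek; rewrite /eps bp (negbTE ek) mul1r mulrN1.
rewrite (_ : \sum_(i | _) _ = - S); last first.
  rewrite Skp -sumrN; apply: eq_bigr => b bk; rewrite -sumrN; apply: eq_bigr => e _.
  case: (boolP (in_p blk e)) => ep; first by rewrite /eps ep (negbTE bk) mulr1 mulrN1.
  by rewrite sqr_killing3_swap killing3_in_kp ?expr0n ?mul0r ?oppr0.
rewrite /eps ap; lra.
Qed.
End KillingSums.

(** * Bounds on [kappa] and dimension counts *)

Section KappaBounds.
Variables (R : realType) (N r s : nat).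
Variables (c : 'I_N -> 'I_N -> 'rV[R]_N) (blk : 'I_N -> option 'I_(r + s)).
Variable kappa : 'I_(r + s) -> R.
Hypotheses (setup : cartan_setup c blk) (kappaE : kappa_spec c blk kappa).
Local Notation eps := (cartan_sign R blk).
Local Notation A := (killing3 c eps).

Lemma in_ki_exists i : exists a, in_ki blk i a.
Proof. by case: setup => _ [_ [_ [_ [_ [_ [_ [_ [h _]]]]]]]]. Qed.

Lemma dim_ki_gt0 i : (0 < dim_ki blk i)%N.
Proof. by have [a ai] := in_ki_exists i; apply/card_gt0P; exists a. Qed.

Lemma dim_p_gt0 : (0 < dim_p blk)%N.
Proof. by case: setup => _ [_ [[a ap] _]]; apply/card_gt0P; exists a. Qed.

Lemma kappa_ge0 i : 0 <= kappa i.
Proof.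
have [a ai] := in_ki_exists i; rewrite -(sum_killing3_ki setup kappaE ai).
by apply: sumr_ge0 => b _; apply: sumr_ge0 => e _; exact: sqr_ge0.
Qed.

(** The centre is abelian, so all the squares vanish. This extends the maximality of
    [kappa m / Ti m] from the simple ideals to every index. *)
Lemma kappa_center (i : 'I_(r + s)) : (r <= i)%N -> kappa i = 0.
Proof.
move=> ri; have [a ai] := in_ki_exists i; rewrite -(sum_killing3_ki setup kappaE ai).
case: setup => _ [_ [_ [_ [_ [_ [_ [_ [_ [_ [_ center]]]]]]]]]].
apply: big1 => b bi; apply: big1 => e _.
by rewrite /killing3 (center i) // mxE mul0r expr0n.
Qed.

(* If [kappa i = 1] then [k_i] commutes with [p], so it is a proper nonzero ideal. *)
Lemma kappa_lt1 i : kappa i < 1.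
Proof.
have [a0 a0i] := in_ki_exists i.
rewrite lt_def; apply/andP; split; last first.
  rewrite -subr_ge0 -(sum_killing3_p setup kappaE a0i).
  by apply: sumr_ge0 => b _; apply: sumr_ge0 => e _; exact: sqr_ge0.
apply/eqP => k1.
(* The sum of squares equal to [1 - kappa i] is zero, so each of its terms is. *)
have Akp a b e : in_ki blk i a -> in_p blk b -> A a b e = 0.
  move=> ai bp; apply/eqP; rewrite -sqrf_eq0; apply/eqP.
  have := sum_killing3_p setup kappaE ai; rewrite -k1 subrr.
  move/psumr_eq0P => h; have := h _ b bp.
  move/(_ (fun b _ => sumr_ge0 _ (fun e _ => sqr_ge0 _)))/psumr_eq0P.
  by apply=> // ? _; exact: sqr_ge0.
have ideal a b : in_ki blk i a -> in_span (in_ki blk i) (c a b).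
  move=> ai e ei; rewrite (structure_killing3 c (cartan_sign2 R blk)).
  case: (boolP (in_p blk b)) => bp; first by rewrite Akp // mul0r.
  by rewrite (killing3_in_ki setup ai bp) ?mul0r // negb_and ei orbT.
case: setup => _ [[_ simple] [[p0 p0p] _]].
have [||/(_ (bvec a0))|/(_ (bvec p0) p0)] := simple (in_span (in_ki blk i)).
- split; [by move=> a _; rewrite mxE | split].
    by move=> x y xP yP a ai; rewrite mxE xP // yP // addr0.
  by move=> k x xP a ai; rewrite mxE xP // mulr0.
- move=> x y xP e ei; rewrite lbrE big1 // => a _; rewrite big1 // => b _.
  case: (boolP (in_ki blk i a)) => ai; first by rewrite ideal // mulr0.
  by rewrite xP // !mul0r.
- move=> h; have /rowP/(_ a0) : (bvec a0 : 'rV[R]_N) = 0.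
    by apply: h => a ai; rewrite mxE eqxx /=; case: eqP => // aa; rewrite aa a0i in ai.
  by rewrite !mxE !eqxx => /eqP; rewrite oner_eq0.
- move=> h; have : (bvec p0 : 'rV[R]_N) 0 p0 = 0.
    by apply: h; move: p0p; rewrite /in_p /in_ki => /eqP->.
  by rewrite mxE !eqxx => /eqP; rewrite oner_eq0.
Qed.

Lemma sum_in_k (F : 'I_N -> R) :
  \sum_(a | in_k blk a) F a = \sum_i \sum_(a | in_ki blk i a) F a.
Proof.
under [RHS]eq_bigr do rewrite big_mkcond.
rewrite exchange_big big_mkcond; apply: eq_bigr => a _ /=.
rewrite /in_k /in_ki; case: (blk a) => [j|] /=; last by rewrite big1.
by rewrite (bigD1 j) //= eqxx big1 ?addr0 // => i ij; case: eqP => // -[ji]; rewrite ji eqxx in ij.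
Qed.

Lemma sum_in_ki_const i (x : R) : \sum_(a | in_ki blk i a) x = (dim_ki blk i)%:R * x.
Proof. by rewrite sumr_const mulr_natl. Qed.

Lemma sum_in_p_const (x : R) : \sum_(a | in_p blk a) x = (dim_p blk)%:R * x.
Proof. by rewrite sumr_const mulr_natl. Qed.

Lemma dim_kE : (dim_k blk)%:R = \sum_i (dim_ki blk i)%:R :> R.
Proof.
have -> : (dim_k blk)%:R = \sum_(a | in_k blk a) 1 :> R by rewrite sumr_const.
by rewrite sum_in_k; apply: eq_bigr => i _; rewrite sum_in_ki_const mulr1.
Qed.

(* Both sides count [sum A a b e ^+ 2] over [a] in [k] and [b, e] in [p]. *)
Lemma sum_one_minus_kappa :
  \sum_i (dim_ki blk i)%:R * (1 - kappa i) = (dim_p blk)%:R / 2.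
Proof.
transitivity (\sum_(a | in_k blk a) \sum_(b | in_p blk b) \sum_e A a b e ^+ 2).
  rewrite sum_in_k; apply: eq_bigr => i _; rewrite -sum_in_ki_const.
  by apply: eq_bigr => a ai; rewrite (sum_killing3_p setup kappaE ai).
rewrite exchange_big /= -sum_in_p_const; apply: eq_bigr => b bp.
rewrite -(sum_killing3_pp setup bp) [RHS]exchange_big /= [RHS](bigID (in_p blk)) /=.
rewrite [X in X + _]big1 ?add0r => [|e ep]; last first.
  by rewrite big1 // => a ap; rewrite (killing3_in_pp setup) ?expr0n.
apply: eq_bigr => a ak; rewrite (bigID (in_p blk)) /= [X in _ + X]big1 ?addr0 => [|e ep].
  by apply: eq_bigr => e ep; rewrite (killing3_cycle setup).
by rewrite (killing3_in_kp setup) ?expr0n.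
Qed.
End KappaBounds.

(** * Scalar curvature of the metrics in the family, and the maximum *)

Section NaturallyReductive.
Variables (R : realType) (N r s : nat).
Variables (c : 'I_N -> 'I_N -> 'rV[R]_N) (blk : 'I_N -> option 'I_(r + s)).
Variable kappa : 'I_(r + s) -> R.
Hypotheses (setup : cartan_setup c blk) (kappaE : kappa_spec c blk kappa).
Local Notation eps := (cartan_sign R blk).
Local Notation A := (killing3 c eps).

Section BlockMetric.
Variables (beta : R) (alpha : 'I_(r + s) -> R).
Hypotheses (beta_gt0 : 0 < beta) (alpha_gt0 : forall i, 0 < alpha i).

Let w a : R := if blk a is Some i then alpha i else beta.
Let h a := eps a * w a.
(** The summand of [scal_diag] for this metric; its sum is split below according to whether [a] and
    [b] lie in [k] or in [p]. *)
Let term a b e : R := A a b e ^+ 2 / (w a * w b * w e) *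
  (3 * h e ^+ 2 - h a ^+ 2 - h b ^+ 2 + 2 * h a * h b - 2 * h e * h a - 2 * h e * h b).

Let w_neq0 a : w a != 0.
Proof. by rewrite gt_eqF // /w; case: (blk a). Qed.

Let w_ki i a : in_ki blk i a -> w a = alpha i.
Proof. by rewrite /in_ki /w => /eqP->. Qed.

Let w_p a : in_p blk a -> w a = beta.
Proof. by rewrite /in_p /w => /eqP->. Qed.

Let h_p a : in_p blk a -> h a = beta.
Proof. by move=> ap; rewrite /h (w_p ap) /cartan_sign ap mul1r. Qed.

Let h_k a : in_k blk a -> h a = - w a.
Proof. by rewrite in_kE /h /cartan_sign => /negbTE->; rewrite mulN1r. Qed.

(** All three indices of a nonzero term lie in one [k_i], where the quadratic factor equals
    [- alpha i ^+ 2]. *)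
Let sum_kk : \sum_(a | in_k blk a) \sum_(b | in_k blk b) \sum_e term a b e =
  - \sum_i (dim_ki blk i)%:R * (kappa i / alpha i).
Proof.
rewrite sum_in_k -sumrN; apply: eq_bigr => i _.
rewrite -mulrN -(sum_in_ki_const blk i).
apply: eq_bigr => a ai; rewrite -(sum_killing3_k setup kappaE ai) -mulNr -sumrN mulr_suml.
apply: eq_bigr => b bk; rewrite -sumrN mulr_suml; apply: eq_bigr => e _; rewrite /term.
case: (eqVneq (A a b e) 0) => [->|nz]; first by rewrite expr0n !mul0r oppr0 mul0r.
have [bi ei] := killing3_out_k setup ai bk nz.
rewrite !h_k ?(in_ki_k ai) ?(in_ki_k bi) ?(in_ki_k ei) //.
rewrite (w_ki ai) (w_ki bi) (w_ki ei); field; exact: lt0r_neq0.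
Qed.

(** With [h a = - alpha i] and [h b = h e = beta] the quadratic factor is again [- alpha i ^+ 2],
    now divided by [alpha i * beta ^+ 2]. *)
Let sum_kp : \sum_(a | in_k blk a) \sum_(b | in_p blk b) \sum_e term a b e =
  - \sum_i (dim_ki blk i)%:R * ((1 - kappa i) * alpha i / beta ^+ 2).
Proof.
rewrite sum_in_k -sumrN; apply: eq_bigr => i _.
rewrite -mulrN -(sum_in_ki_const blk i).
apply: eq_bigr => a ai; rewrite -(sum_killing3_p setup kappaE ai) -!mulNr -mulrA -sumrN mulr_suml.
apply: eq_bigr => b bp; rewrite -sumrN mulr_suml; apply: eq_bigr => e _; rewrite /term.
case: (boolP (in_p blk e)) => ep; last first.
  by rewrite (killing3_in_kp setup (in_ki_k ai) bp ep) expr0n !mul0r oppr0 mul0r.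
rewrite (h_k (in_ki_k ai)) (h_p bp) (h_p ep) (w_p bp) (w_p ep) (w_ki ai).
by field; rewrite !lt0r_neq0.
Qed.

Let sum_pk : \sum_(a | in_p blk a) \sum_(b | in_k blk b) \sum_e term a b e =
  - \sum_i (dim_ki blk i)%:R * ((1 - kappa i) * alpha i / beta ^+ 2).
Proof.
rewrite -sum_kp exchange_big; apply: eq_bigr => a _; apply: eq_bigr => b _.
apply: eq_bigr => e _; rewrite /term (sqr_killing3_swap setup).
by field; rewrite !w_neq0.
Qed.

(** Here [e] must lie in some [k_i]; with [h e = - alpha i] and [h a = h b = beta] the quadratic
    factor is [3 * alpha i ^+ 2 + 4 * alpha i * beta]. *)
Let sum_pp : \sum_(a | in_p blk a) \sum_(b | in_p blk b) \sum_e term a b e =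
  \sum_i (dim_ki blk i)%:R * ((1 - kappa i) * (3 * alpha i / beta ^+ 2 + 4 / beta)).
Proof.
transitivity (\sum_(e | in_k blk e) \sum_(a | in_p blk a) \sum_(b | in_p blk b) term a b e).
  rewrite [RHS]exchange_big; apply: eq_bigr => a ap /=.
  rewrite [RHS]exchange_big; apply: eq_bigr => b bp /=.
  rewrite (bigID (in_p blk)) /= big1 ?add0r // => e ep.
  by rewrite /term (killing3_in_pp setup) // expr0n !mul0r.
rewrite sum_in_k; apply: eq_bigr => i _; rewrite -(sum_in_ki_const blk i).
apply: eq_bigr => e ei; rewrite -(sum_killing3_p setup kappaE ei) mulr_suml.
apply: eq_bigr => a ap; rewrite [in RHS](bigID (in_p blk)) /=.
rewrite [X in _ + X]big1 ?addr0 => [|b bp]; last first.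
  by rewrite (killing3_in_kp setup (in_ki_k ei) ap bp) expr0n.
rewrite mulr_suml; apply: eq_bigr => b bp; rewrite /term (killing3_cycle setup e a b).
rewrite (h_k (in_ki_k ei)) (h_p ap) (h_p bp) (w_p ap) (w_p bp) (w_ki ei).
by field; rewrite !lt0r_neq0.
Qed.

Lemma scal_nr_metric : 4 * scal c (nr_metric blk beta alpha) =
  scal4 (fun i => (dim_ki blk i)%:R) kappa (dim_p blk)%:R beta^-1 (fun i => (alpha i)^-1).
Proof.
have wE a : (\row_a match blk a with None => beta | Some i => alpha i end) 0 a = w a.
  by rewrite mxE /w; case: (blk a).
rewrite /nr_metric (scal_diag (eps := eps) (A := A)); first last.
- by move=> a; rewrite wE.
- exact: killing3_antil.
- exact: killing3_cycle.
- exact: structure_killing3 (cartan_sign2 R blk).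
rewrite (_ : \sum_a _ = \sum_a \sum_b \sum_e term a b e); last first.
  by do 3!apply: eq_bigr => ? _; rewrite !wE.
rewrite (bigID (in_p blk)) /=; under eq_bigr do rewrite (bigID (in_p blk)) /=.
under [X in _ + X]eq_bigr do rewrite (bigID (in_p blk)) /=.
rewrite !big_split /= sum_pp sum_pk sum_kp sum_kk /scal4.
set S1 := \sum_i _ * (kappa i / _); set S2 := \sum_i _ * (_ / beta ^+ 2).
set S3 := \sum_i _ * (_ * (_ + _)).
have -> : \sum_i (dim_ki blk i)%:R *
    (kappa i * (alpha i)^-1 - (1 - kappa i) * beta^-1 ^+ 2 / (alpha i)^-1) = S1 - S2.
  by rewrite -sumrB; apply: eq_bigr => i _; field; rewrite !lt0r_neq0.
(* The identity [\sum_i d i * (1 - kappa i) = n / 2] turns the [4 / beta] terms into the linear term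
   [2 * n / beta] of [scal4]. *)
have -> : S3 = 3 * S2 + 2 * (dim_p blk)%:R / beta.
  have -> : (dim_p blk)%:R = 2 * ((dim_p blk)%:R / 2) :> R by field.
  rewrite -(sum_one_minus_kappa setup kappaE) !mulr_sumr mulr_suml -big_split /=.
  by apply: eq_bigr => i _; field; exact: lt0r_neq0.
ring.
Qed.

(** This identifies the trace condition of [in_MTplus] with the constraint of [feasible] in the
    inverse parameters. *)
Lemma trace_nr_metric (Tp : R) (Ti : 'I_(r + s) -> R) :
  trace_wrt (nr_metric blk beta alpha) (tensorT blk Tp Ti) =
  - (dim_p blk)%:R * Tp * beta^-1 + \sum_i (dim_ki blk i)%:R * Ti i * (alpha i)^-1.
Proof.
rewrite /trace_wrt /nr_metric invmx_diag => [|a]; last by rewrite mxE; exact: w_neq0.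
rewrite mul_diag_mx /mxtrace (bigID (in_p blk)) /=; congr (_ + _).
  rewrite !mulNr -mulrA -mulrN -sum_in_p_const; apply: eq_bigr => a.
  by rewrite !mxE eqxx mulr1n /in_p => /eqP->; rewrite mulrN mulrC.
rewrite sum_in_k; apply: eq_bigr => i _; rewrite -mulrA -sum_in_ki_const.
by apply: eq_bigr => a; rewrite !mxE eqxx mulr1n /in_ki => /eqP->; rewrite mulrC.
Qed.
End BlockMetric.
End NaturallyReductive.

(** The form [Q] itself belongs to the family, so its trace of the tensor is a case of
    [trace_nr_metric]. *)
Lemma nr_metric1 (R : realType) (N r s : nat) (blk : 'I_N -> option 'I_(r + s)) :
  nr_metric blk 1 (fun=> 1) = 1%:M :> 'M[R]_N.
Proof.
apply/matrixP => a b; rewrite !mxE.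
by case: (a == b); rewrite ?mulr1n ?mulr0n //; case: (blk a).
Qed.

Theorem theorem5p3 (R : realType) (N r s : nat)
  (c : 'I_N -> 'I_N -> 'rV[R]_N) (blk : 'I_N -> option 'I_(r + s))
  (kappa : 'I_(r + s) -> R) (Tp : R) (Ti : 'I_(r + s) -> R) (m : 'I_(r + s)) :
  cartan_setup c blk ->
  kappa_spec c blk kappa ->
  0 < Tp -> (forall i, 0 < Ti i) ->
  (m < r)%N ->
  (forall i : 'I_(r + s), (i < r)%N -> kappa i / Ti i <= kappa m / Ti m) ->
  kappa m * trace_wrt (1%:M : 'M[R]_N) (tensorT blk Tp Ti) / Ti m
    < (dim_k blk)%:R + (dim_ki blk m)%:R * (1 - kappa m) - 3 * (dim_p blk)%:R ->
  \sum_(i < r + s)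
      ((dim_p blk)%:R ^+ 2 * kappa i * Tp ^+ 2
       - (dim_ki blk i)%:R ^+ 2 * (1 - kappa i) * Ti i ^+ 2)
      / ((dim_p blk)%:R * Tp * Ti i)
    - 2 * (dim_p blk)%:R < 0 ->
  exists beta alpha,
    in_MTplus blk Tp Ti beta alpha /\
    forall beta' alpha', in_MTplus blk Tp Ti beta' alpha' ->
      scal c (nr_metric blk beta' alpha') <= scal c (nr_metric blk beta alpha).
Proof.
move=> setup kappaE Tp0 Ti0 mr maxm C1 C2.
have n0 : (0 : R) < (dim_p blk)%:R by rewrite ltr0n (dim_p_gt0 setup).
have d0 i : (0 : R) < (dim_ki blk i)%:R by rewrite ltr0n (dim_ki_gt0 setup).
have k0 := kappa_ge0 setup kappaE.
have maxm' i : kappa i / Ti i <= kappa m / Ti m.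
  have [/maxm //|ri] := ltnP i r.
  by rewrite (kappa_center setup kappaE ri) mul0r divr_ge0 // ltW.
have C1' : kappa m * (- (dim_p blk)%:R * Tp + \sum_i (dim_ki blk i)%:R * Ti i) / Ti m
    < \sum_i (dim_ki blk i)%:R + (dim_ki blk m)%:R * (1 - kappa m) - 3 * (dim_p blk)%:R.
  rewrite -(dim_kE R blk); move: C1; rewrite -(nr_metric1 R blk) trace_nr_metric //.
  rewrite invr1 mulr1; under eq_bigr do rewrite mulr1; exact.
have [x [y [[x0 y0 E] max_xy]]] := max_scal4_exists n0 Tp0 d0 Ti0 k0
  (kappa_lt1 setup kappaE) maxm' (sum_one_minus_kappa setup kappaE) C1' C2.
have xV : 0 < x^-1 by rewrite invr_gt0.
have yV i : 0 < (y i)^-1 by rewrite invr_gt0.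
(* Inversion maps positive parameters to positive parameters and is its own inverse, so the
   maximiser of the reduced problem transfers back to a metric. *)
exists x^-1, (fun i => (y i)^-1); split.
  split=> //; split=> //; rewrite trace_nr_metric // invrK.
  by under eq_bigr do rewrite invrK.
move=> beta alpha [beta0 [alpha0]]; rewrite trace_nr_metric // => trace1.
rewrite -(@ler_pM2l _ 4) //  !(scal_nr_metric setup kappaE) // invrK.
rewrite (_ : (fun i => (y i)^-1^-1) = y); last by apply/funext => i; rewrite invrK.
by apply: max_xy; split=> // [|i]; rewrite invr_gt0.
Qed.
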